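(* Let $S\subset T\subset\mathbb{R}^2$, with $|S|=2$ and $|T|=4$. Then $V_T(S)$ is not an unbounded polygon with parallel sides and just two vertices (i.e. it is not an unbounded convex polygon with exactly two vertices and three sides whose two unbounded sides are parallel).
   Context: For a finite nonempty set $T\subset\mathbb{R}^n$ and a nonempty proper subset $S\subset T$, the multipoint (higher order) Voronoi cell is $$V_T(S):=\left\{x\in\mathbb{R}^n : \max_{s\in S}\|x-s\|\le\min_{t\in T\setminus S}\|x-t\|\right\},$$ where $\|\cdot\|$ is the Euclidean norm. An unbounded convex polygon is an unbounded intersection of finitely many closed halfplanes in $\mathbb{R}^2$ with nonempty interior; its sides are its one-dimensional faces and its vertices are its extreme points. *)

(* Defs.v *)
From mathcomp Require Export all_boot all_order all_algebra.
From mathcomp Require Export finmap.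
From mathcomp Require Export all_classical all_reals all_analysis.

Set Implicit Arguments.
Unset Strict Implicit.
Unset Printing Implicit Defensive.

Import Order.TTheory GRing.Theory Num.Theory.
Import numFieldNormedType.Exports.

Local Open Scope classical_set_scope.
Local Open Scope card_scope.
Local Open Scope ring_scope.

Definition dotv {R : realType} {n : nat} (x y : 'rV[R]_n) : R :=
  \sum_(i < n) x 0 i * y 0 i.

(* The library norm `|x| on 'rV[R]_n is the sup norm, so the Euclidean norm is
   introduced separately. *)
Definition enorm {R : realType} {n : nat} (x : 'rV[R]_n) : R :=
  Num.sqrt (dotv x x).

(* The max and the min are taken in \bar R so that their neutral elements are
   the genuine ones; over nonempty families they are the real max and min. *)
Definition voronoi_cell {R : realType} {n : nat} (T S : {fset 'rV[R]_n}) :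
    set 'rV[R]_n :=
  [set x | (\big[maxe/-oo]_(s <- S) (enorm (x - s))%:E <=
            \big[mine/+oo]_(t <- (T `\` S)%fset) (enorm (x - t))%:E)%E].

Definition closed_halfspace {R : realType} {n : nat} (H : set 'rV[R]_n) :=
  exists (a : 'rV[R]_n) (b : R), a != 0 /\ H = [set x | dotv a x <= b].

(* Bounded sets and interiors do not depend on the choice of a norm on R^2, so
   the library notions, which refer to the sup norm, are the Euclidean ones. *)
Definition unbounded_convex_polygon {R : realType} (P : set 'rV[R]_2) :=
  [/\ exists m (H : 'I_m -> set 'rV[R]_2),
        (forall i, closed_halfspace (H i)) /\ P = \bigcap_(i in setT) H i,
      P° !=set0
    & ~ bounded_set P].

Definition extreme_point {R : realType} {V : lmodType R} (P : set V) (x : V) :=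
  P x /\ forall y z (t : R), P y -> P z -> 0 < t < 1 ->
    x = t *: y + (1 - t) *: z -> y = x /\ z = x.

Definition face {R : realType} {V : lmodType R} (P F : set V) :=
  [/\ convex_set F, F `<=` P
    & forall y z (t : R), P y -> P z -> 0 < t < 1 ->
        F (t *: y + (1 - t) *: z) -> F y /\ F z].

(* The direction of the affine hull of F: the least linear subspace containing
   all the differences of points of F. *)
Definition is_direction {R : realType} {V : vectType R} (F : set V)
    (U : {vspace V}) :=
  (forall x y, F x -> F y -> x - y \in U) /\
  (forall W : {vspace V},
     (forall x y, F x -> F y -> x - y \in W) -> (U <= W)%VS).

Definition has_affine_dim {R : realType} {V : vectType R} (F : set V)
    (k : nat) :=
  F !=set0 /\ exists2 U : {vspace V}, is_direction F U & \dim U = k.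

Definition parallel {R : realType} {V : vectType R} (F G : set V) :=
  exists2 U : {vspace V}, is_direction F U & is_direction G U.

Definition vertices {R : realType} (P : set 'rV[R]_2) : set 'rV[R]_2 :=
  [set x | extreme_point P x].

Definition sides {R : realType} (P : set 'rV[R]_2) : set (set 'rV[R]_2) :=
  [set F | face P F /\ has_affine_dim F 1].

Definition two_vertices_parallel_sides {R : realType} (P : set 'rV[R]_2) :=
  [/\ unbounded_convex_polygon P,
      vertices P #= `I_2,
      sides P #= `I_3
    & exists F G, [/\ F <> G,
        [set K | sides P K /\ ~ bounded_set K] = [set F; G]
      & parallel F G]].

(* Main.v *)
(** Write S = {s_0, s_1}, T \ S = {t_0, t_1} and
    f_ij(x) = |x - t_j|^2 - |x - s_i|^2. These four functions are affine, the
    cell is {f_ij >= 0 for all i, j}, and f_00 + f_11 = f_01 + f_10.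
    The two parallel unbounded sides lie on the zero lines of two different f_ij;
    along their common direction u, chosen so that all slopes of the f_ij are
    nonnegative, these two have slope 0, and some slope is nonzero since the cell
    has a vertex. If the two functions have no index in common, the relation
    makes the two other slopes add up to 0, a contradiction. Otherwise the two
    remaining functions have the same positive slope along u, and the relation
    shows that both of them contribute to the boundary, which yields three
    vertices. *)
Require Import Defs.
From mathcomp Require Import ring lra.

Set Implicit Arguments.
Unset Strict Implicit.
Unset Printing Implicit Defensive.

Import Order.TTheory GRing.Theory Num.Theory.
Import numFieldNormedType.Exports.
Local Open Scope classical_set_scope.
Local Open Scope ring_scope.

(** * Dot products, in general and in the plane *)

Lemma dotvDr (R : realType) n (a x y : 'rV[R]_n) :
  dotv a (x + y) = dotv a x + dotv a y.
Proof. by rewrite -big_split; apply: eq_bigr => i _; rewrite !mxE mulrDr. Qed.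

Lemma dotvZr (R : realType) n (a x : 'rV[R]_n) (c : R) :
  dotv a (c *: x) = c * dotv a x.
Proof. by rewrite mulr_sumr; apply: eq_bigr => i _; rewrite !mxE mulrCA. Qed.

Lemma dotvC (R : realType) n (x y : 'rV[R]_n) : dotv x y = dotv y x.
Proof. by apply: eq_bigr => i _; rewrite mulrC. Qed.

Lemma dotvNr (R : realType) n (a x : 'rV[R]_n) : dotv a (- x) = - dotv a x.
Proof. by rewrite -scaleN1r dotvZr mulN1r. Qed.

Lemma dotvBr (R : realType) n (a x y : 'rV[R]_n) :
  dotv a (x - y) = dotv a x - dotv a y.
Proof. by rewrite dotvDr dotvNr. Qed.

Lemma dotv_ge0 (R : realType) n (x : 'rV[R]_n) : 0 <= dotv x x.
Proof. by apply: sumr_ge0 => i _; rewrite -expr2 sqr_ge0. Qed.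

Lemma dotv2 (R : realType) (x y : 'rV[R]_2) :
  dotv x y = x 0 0 * y 0 0 + x 0 1 * y 0 1.
Proof.
rewrite /dotv !big_ord_recl big_ord0 addr0.
by congr (_ + x _ _ * y _ _); apply/val_inj.
Qed.

Lemma row2_eq (R : realType) (x y : 'rV[R]_2) :
  x 0 0 = y 0 0 -> x 0 1 = y 0 1 -> x = y.
Proof.
move=> e0 e1; apply/rowP => -[[|[|//]] j2].
  by rewrite (_ : Ordinal j2 = 0)//; apply/val_inj.
by rewrite (_ : Ordinal j2 = 1)//; apply/val_inj.
Qed.

Lemma row2_neq0 (R : realType) (x : 'rV[R]_2) :
  x != 0 -> (x 0 0 != 0) || (x 0 1 != 0).
Proof.
apply: contraNT; rewrite negb_or !negbK => /andP[/eqP x0 /eqP x1].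
by apply/eqP/row2_eq; rewrite mxE.
Qed.

Lemma dotv2_gt0 (R : realType) (x : 'rV[R]_2) : x != 0 -> 0 < dotv x x.
Proof.
move=> /row2_neq0 x0; rewrite dotv2 -!expr2 lt_def addr_ge0 ?sqr_ge0// andbT.
by rewrite paddr_eq0 ?sqr_ge0// !sqrf_eq0 negb_and.
Qed.

(** Orthogonality to the same [a != 0] makes the determinant of [u] and [w] vanish ([d0]); the
    factor is the projection coefficient of [w] onto [u]. *)
Lemma orthogonal_line (R : realType) (a u w : 'rV[R]_2) :
  a != 0 -> u != 0 -> dotv a u = 0 -> dotv a w = 0 -> exists c, w = c *: u.
Proof.
move=> a0 u0 au aw; exists (dotv u w / dotv u u).
have uu : dotv u u != 0 by rewrite gt_eqF ?dotv2_gt0.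
have d0 : u 0 0 * w 0 1 = u 0 1 * w 0 0.
  move: au aw; rewrite !dotv2 => au aw.
  have [aj|aj] := orP (row2_neq0 a0); apply: (mulfI aj).
    have -> : a 0 0 * (u 0 0 * w 0 1) = (a 0 0 * u 0 0) * w 0 1 by ring.
    have -> : a 0 0 * u 0 0 = - (a 0 1 * u 0 1) by lra.
    have -> : a 0 0 * (u 0 1 * w 0 0) = (a 0 0 * w 0 0) * u 0 1 by ring.
    have -> : a 0 0 * w 0 0 = - (a 0 1 * w 0 1) by lra.
    ring.
  have -> : a 0 1 * (u 0 0 * w 0 1) = (a 0 1 * w 0 1) * u 0 0 by ring.
  have -> : a 0 1 * w 0 1 = - (a 0 0 * w 0 0) by lra.
  have -> : a 0 1 * (u 0 1 * w 0 0) = (a 0 1 * u 0 1) * w 0 0 by ring.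
  have -> : a 0 1 * u 0 1 = - (a 0 0 * u 0 0) by lra.
  ring.
apply: row2_eq; rewrite !mxE; apply: (mulIf uu);
  rewrite [RHS]mulrAC divfK// !dotv2.
  transitivity (w 0 0 * u 0 0 * u 0 0 + (u 0 1 * w 0 0) * u 0 1); first by ring.
  by rewrite -d0; ring.
transitivity ((u 0 0 * w 0 1) * u 0 0 + w 0 1 * u 0 1 * u 0 1); first by ring.
by rewrite d0; ring.
Qed.

(** * Affine functions, polyhedra and their sides *)

Definition aff (R : realType) n (k : 'rV[R]_n * R) (x : 'rV[R]_n) : R :=
  dotv k.1 x + k.2.

Lemma affD (R : realType) n (k : 'rV[R]_n * R) (x w : 'rV[R]_n) :
  aff k (x + w) = aff k x + dotv k.1 w.
Proof. by rewrite /aff dotvDr addrAC. Qed.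

Lemma aff_conv (R : realType) n (k : 'rV[R]_n * R) (x y : 'rV[R]_n) (t : R) :
  aff k (t *: x + (1 - t) *: y) = t * aff k x + (1 - t) * aff k y.
Proof. by rewrite /aff dotvDr !dotvZr; ring. Qed.

Definition polyhedron (R : realType) n (I : finType) (k : I -> 'rV[R]_n * R) :
    set 'rV[R]_n :=
  [set x | forall i, 0 <= aff (k i) x].

Lemma polyhedron_interior_dir (R : realType) n (I : finType)
    (k : I -> 'rV[R]_n * R) (m w : 'rV[R]_n) :
    (forall i, 0 < aff (k i) m) ->
  exists2 e, 0 < e & polyhedron k (m + e *: w) /\ polyhedron k (m - e *: w).
Proof.
(* [s] dominates every ratio of absolute slope to value at [m], so moving by [s^-1] times [w] either
   way violates no constraint; the summand 1 keeps [s] positive even if all slopes vanish. *)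
move=> m0; pose s := 1 + \sum_i `|dotv (k i).1 w| / aff (k i) m.
have q0 i : 0 <= `|dotv (k i).1 w| / aff (k i) m by rewrite divr_ge0// ltW.
have s0 : 0 < s by rewrite ltr_pwDl// sumr_ge0.
have small i : `|s^-1 * dotv (k i).1 w| <= aff (k i) m.
  rewrite normrM gtr0_norm ?invr_gt0// mulrC ler_pdivrMr// mulrC.
  rewrite -ler_pdivrMr// /s (bigD1 i)//= addrCA lerDl addr_ge0//.
  exact: sumr_ge0.
exists s^-1; first by rewrite invr_gt0.
split=> i; move: (small i); rewrite affD ?dotvNr dotvZr ler_norml.
  by move=> /andP[]; lra.
by move=> /andP[]; lra.
Qed.

(** By minimality of [U], a set without two distinct points would have direction 0; in dimension 1
    any nonzero difference spans. *)
Lemma direction1 (R : realType) (F : set 'rV[R]_2) (U : {vspace 'rV[R]_2}) :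
    is_direction F U -> \dim U = 1%N ->
  exists x y, [/\ F x, F y, x != y & U = <[x - y]>%VS].
Proof.
move=> [FU Umin] dU.
have [[x [y [Fx Fy xy]]]|noxy] :=
    pselect (exists x y, [/\ F x, F y & x != y]).
  exists x, y; split => //; apply/eqP; rewrite eq_sym eqEdim dU.
  by rewrite dim_vline subr_eq0 xy -memvE FU.
have : (U <= 0)%VS.
  apply: Umin => x y Fx Fy; rewrite memv0 subr_eq0; apply: contrapT => /negP xy.
  by apply: noxy; exists x, y.
by rewrite subv0 => /eqP U0; move: dU; rewrite U0 dimv0.
Qed.

(** Some constraint is tight at the midpoint [m] of two distinct points of [F], and is then constant
    along [F]. Conversely, any other point of the polyhedron on its zero line is the end of a
    segment of the polyhedron with [m] inside, so the face property puts it in [F]. *)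
Lemma polyhedron_side (R : realType) (I : finType) (k : I -> 'rV[R]_2 * R)
    (F : set 'rV[R]_2) (U : {vspace 'rV[R]_2}) :
    (forall i, (k i).1 != 0) ->
    face (polyhedron k) F -> is_direction F U -> \dim U = 1%N ->
  exists2 i, forall u, u \in U -> dotv (k i).1 u = 0
           & F = polyhedron k `&` [set x | aff (k i) x = 0].
Proof.
move=> k0 [cF FP faceF] dirF dU.
have [x [y [Fx Fy xy defU]]] := direction1 dirF dU.
set u := x - y in defU.
have u0 : u != 0 by rewrite subr_eq0.
pose m : 'rV[R]_2 := 2^-1 *: x + (1 - 2^-1) *: y.
have Fm : F m.
  have [h0 h1] : 0 <= 2^-1 :> R /\ 2^-1 <= 1 :> R by split; lra.
  pose h : {i01 R} := Itv01 h0 h1.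
  by have := cF x y h (mem_set Fx) (mem_set Fy); rewrite inE.
have mx : x = m + 2^-1 *: u by apply/rowP => j; rewrite !mxE; field.
have my : y = m + (- 2^-1) *: u by apply/rowP => j; rewrite !mxE; field.
clearbody m.
(* If no constraint were tight at [m], the face [F] would contain a segment
   around [m] in every direction. *)
have [i im0] : exists i, aff (k i) m = 0.
  apply: contrapT => noi.
  have m0 i : 0 < aff (k i) m.
    rewrite lt_def FP// andbT; apply/eqP => im0; apply: noi; by exists i.
  have : (fullv <= U)%VS.
    apply/subvP => w _; have [e e0 [Pp Pm]] := polyhedron_interior_dir w m0.
    have mE : m = 2^-1 *: (m + e *: w) + (1 - 2^-1) *: (m - e *: w).
      by apply/rowP => j; rewrite !mxE; field.
    have [] := faceF (m + e *: w) (m - e *: w) 2^-1 Pp Pm.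
    - lra.
    - by rewrite -mE.
    move=> Fp _; have := dirF.1 _ _ Fp Fm.
    by rewrite addrC addKr => eU; rewrite -(scalerK (lt0r_neq0 e0) w) memvZ.
  by move=> /dimvS; rewrite dU dimvf /dim /=.
have iu0 : dotv (k i).1 u = 0.
  have := FP _ Fx i; have := FP _ Fy i.
  by rewrite mx my !affD !dotvZr im0; lra.
have iU v : v \in U -> dotv (k i).1 v = 0.
  by rewrite defU => /vlineP[c ->]; rewrite dotvZr iu0 mulr0.
exists i => //; apply/seteqP; split=> z.
  move=> Fz; split; first exact: FP.
  have := iU _ (dirF.1 _ _ Fz Fm).
  by move=> /= zm; rewrite -(subrKC m z) affD im0 zm addr0.
move=> [Pz /= iz].
have [] := @orthogonal_line _ (k i).1 u (z - m) => //.
  by move: iz im0; rewrite dotvBr /aff; lra.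
move=> c; move/eqP; rewrite subr_eq addrC => /eqP zE.
(* Here [z = m + c *: u]: [m] lies strictly between [z] and whichever of [x], [y] is on the other
   side, and [t] is the weight of [z]. *)
have [c0|c0|c0] := ltgtP c 0.
- have d0 : 1 - 2 * c != 0 by rewrite gt_eqF//; lra.
  pose t := (1 - 2 * c)^-1.
  have mE : m = t *: z + (1 - t) *: x.
    by rewrite zE mx /t; apply/rowP => j; rewrite !mxE; field.
  have [] // := faceF z x t Pz (FP _ Fx); last by rewrite -mE.
  by rewrite /t invr_gt0 invf_lt1; lra.
- have d0 : 1 + 2 * c != 0 by rewrite gt_eqF//; lra.
  pose t := (1 + 2 * c)^-1.
  have mE : m = t *: z + (1 - t) *: y.
    by rewrite zE my /t; apply/rowP => j; rewrite !mxE; field.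
  have [] // := faceF z y t Pz (FP _ Fy); last by rewrite -mE.
  by rewrite /t invr_gt0 invf_lt1; lra.
- by rewrite zE c0 scale0r addr0.
Qed.

(** If neither a spanning [u] nor [- u] works, one constraint strictly decreases along the line of
    [F] and another strictly increases, so [F] is cut off at both ends. *)
Lemma unbounded_direction (R : realType) (I : finType)
    (k : I -> 'rV[R]_2 * R) (F : set 'rV[R]_2) (U : {vspace 'rV[R]_2}) :
    F `<=` polyhedron k -> is_direction F U -> \dim U = 1%N ->
    ~ bounded_set F ->
  exists u, [/\ u != 0, u \in U & forall i, 0 <= dotv (k i).1 u].
Proof.
move=> FP dirF dU Fub.
have [x [y [Fx _ xy defU]]] := direction1 dirF dU.
set u := x - y in defU.
have u0 : u != 0 by rewrite subr_eq0.
have uU : u \in U by rewrite defU memv_line.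
apply: contrapT => nou; apply: Fub.
have [i iu] : exists i, dotv (k i).1 u < 0.
  apply: contrapT => noi; apply: nou; exists u; split => // i.
  by rewrite leNgt; apply/negP => iu; apply: noi; exists i.
have [j ju] : exists j, 0 < dotv (k j).1 u.
  apply: contrapT => noj; apply: nou; exists (- u).
  rewrite oppr_eq0 rpredN; split => // j.
  by rewrite dotvNr oppr_ge0 leNgt; apply/negP => ju; apply: noj; exists j.
(* For [z = x + c *: u] in [F], these give [- B <= c <= A]. *)
pose A := aff (k i) x / - dotv (k i).1 u.
pose B := aff (k j) x / dotv (k j).1 u.
have A0 : 0 <= A by rewrite divr_ge0 ?FP// oppr_ge0 ltW.
have B0 : 0 <= B by rewrite divr_ge0 ?FP// ltW.
exists (`|x| + (A + B) * `|u|); split; first exact: num_real.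
move=> M ltM z Fz /=; apply: le_trans (ltW ltM).
have := dirF.1 _ _ Fz Fx; rewrite defU => /vlineP[c].
move/eqP; rewrite subr_eq addrC => /eqP zE.
rewrite zE (le_trans (ler_normD _ _))// lerD2l normrZ ler_wpM2r//.
have cA : c <= A.
  rewrite ler_pdivlMr ?oppr_gt0//; have := FP _ Fz i.
  by rewrite zE affD dotvZr; lra.
have cB : - c <= B.
  rewrite ler_pdivlMr//; have := FP _ Fz j.
  by rewrite zE affD dotvZr; lra.
by rewrite ler_norml; apply/andP; split; lra.
Qed.

(** * Vertices as intersections of tight constraints *)

(** A nonnegative affine function vanishing inside a segment vanishes at its ends, so both gradients
    kill [y - x] and [z - x]. *)
Lemma extreme_point_aff (R : realType) n (P : set 'rV[R]_n)
    (k l : 'rV[R]_n * R) (x : 'rV[R]_n) :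
    (forall y, P y -> 0 <= aff k y) -> (forall y, P y -> 0 <= aff l y) ->
    (forall w, dotv k.1 w = 0 -> dotv l.1 w = 0 -> w = 0) ->
    P x -> aff k x = 0 -> aff l x = 0 -> extreme_point P x.
Proof.
move=> k0 l0 kl Px kx lx; split=> // y z t Py Pz t01 xE.
have tight (h : 'rV[R]_n * R) : (forall y, P y -> 0 <= aff h y) ->
    aff h x = 0 -> dotv h.1 (y - x) = 0 /\ dotv h.1 (z - x) = 0.
  move=> h0 hx; have := hx; rewrite {1}xE aff_conv.
  have ty : 0 <= t * aff h y by rewrite mulr_ge0 ?h0//; lra.
  have tz : 0 <= (1 - t) * aff h z by rewrite mulr_ge0 ?h0//; lra.
  have /andP[t0 t1] := t01; have t1' : 0 < 1 - t by rewrite subr_gt0.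
  move/eqP; rewrite paddr_eq0// !mulf_eq0 (gt_eqF t0) (gt_eqF t1') /=.
  move=> /andP[/eqP hy /eqP hz]; rewrite !dotvBr.
  by move: hx hy hz; rewrite /aff; lra.
have [ky kz] := tight k k0 kx; have [ly lz] := tight l l0 lx.
by split; apply/eqP; rewrite -subr_eq0; apply/eqP/kl.
Qed.

(* [k0] and [k1] cut out the parallel sides, through [p] and [q]. As
   [k3 = k2 + k1 - k0], the constraint [k2] is the stronger of [k2], [k3] on the
   line [k0 = 0] and the weaker one on the line [k1 = 0]: the polygon is closed
   off by a broken line with vertices on these two lines and in between. *)
Lemma three_vertices (R : realType) (P : set 'rV[R]_2)
    (k0 k1 k2 k3 : 'rV[R]_2 * R) (u p q : 'rV[R]_2) :
    (forall x, P x <->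
      [/\ 0 <= aff k0 x, 0 <= aff k1 x, 0 <= aff k2 x & 0 <= aff k3 x]) ->
    (forall x, aff k0 x + aff k3 x = aff k1 x + aff k2 x) ->
    u != 0 -> dotv k0.1 u = 0 -> dotv k1.1 u = 0 -> 0 < dotv k2.1 u ->
    aff k0 p = 0 -> 0 < aff k1 p -> aff k1 q = 0 -> 0 < aff k0 q ->
  exists v1 v2 v3, [/\ v1 != v2, v1 != v3, v2 != v3 &
    [/\ vertices P v1, vertices P v2 & vertices P v3]].
Proof.
move=> PE rel u0 k0u k1u k2u k0p k1p k1q k0q.
have reld w : dotv k0.1 w + dotv k3.1 w = dotv k1.1 w + dotv k2.1 w.
  by have := rel (0 + w); have := rel 0; rewrite !affD; lra.
have k3u : dotv k3.1 u = dotv k2.1 u by have := reld u; lra.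
have k10 : k1.1 != 0.
  apply: contraTneq k1p => e; move: k1q; rewrite /aff e !(dotvC 0).
  by rewrite -(scale0r 0) !dotvZr !mul0r => ->; rewrite ltxx.
(* [k1] has nonzero slope on [p - q] and slope 0 on [u], so [a] is read off from [k1] and the
   remainder is a multiple of [u]. *)
have basis w : exists a b, w = a *: (p - q) + b *: u.
  pose a := dotv k1.1 w / aff k1 p.
  have [] := @orthogonal_line _ k1.1 u (w - a *: (p - q)) => //.
    rewrite dotvBr dotvZr dotvBr.
    have -> : dotv k1.1 p - dotv k1.1 q = aff k1 p.
      by move: k1q; rewrite /aff; lra.
    by rewrite /a divfK ?subrr// gt_eqF.
  by move=> b /eqP; rewrite subr_eq addrC => /eqP wE; exists a, b.
have d0 : dotv k0.1 (p - q) = - aff k0 q.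
  by move: k0p; rewrite dotvBr /aff; lra.
have d1 : dotv k1.1 (p - q) = aff k1 p.
  by move: k1q; rewrite dotvBr /aff; lra.
have k2n : dotv k2.1 u != 0 by rewrite gt_eqF.
have inj02 w : dotv k0.1 w = 0 -> dotv k2.1 w = 0 -> w = 0.
  have [a [b ->]] := basis w; rewrite !dotvDr !dotvZr d0 k0u mulr0 addr0.
  move=> /eqP; rewrite mulf_eq0 oppr_eq0 (gt_eqF k0q) orbF => /eqP ->.
  rewrite mul0r add0r => /eqP; rewrite mulf_eq0 (negPf k2n) orbF => /eqP ->.
  by rewrite !scale0r addr0.
have inj13 w : dotv k1.1 w = 0 -> dotv k3.1 w = 0 -> w = 0.
  have [a [b ->]] := basis w; rewrite !dotvDr !dotvZr d1 k1u mulr0 addr0.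
  move=> /eqP; rewrite mulf_eq0 (gt_eqF k1p) orbF => /eqP ->.
  rewrite mul0r add0r k3u => /eqP; rewrite mulf_eq0 (negPf k2n) orbF => /eqP ->.
  by rewrite !scale0r addr0.
(* By the relation [k0] and [k1] have equal slopes on [w], whereas on [p - q] theirs have opposite
   signs; so [w] has no component along [p - q]. *)
have inj23 w : dotv k2.1 w = 0 -> dotv k3.1 w = 0 -> w = 0.
  move=> w2 w3; apply: inj02 => //.
  have w01 : dotv k0.1 w = dotv k1.1 w by have := reld w; lra.
  move: w01; have [a [b ->]] := basis w.
  rewrite !dotvDr !dotvZr d0 d1 k0u k1u mulr0 !addr0 => e.
  have : a * (aff k0 q + aff k1 p) = 0 by lra.
  move/eqP; rewrite mulf_eq0 (gt_eqF (addr_gt0 k0q k1p)) orbF => /eqP ->.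
  by rewrite mul0r.
(* Moving along [u] preserves [k0] and [k1]; since [k2] and [k3] have the same slope, [slide k]
   reaches the zero line of either. *)
pose slide (k : 'rV[R]_2 * R) x := x - (aff k x / dotv k2.1 u) *: u.
have slide01 k x : aff k0 (slide k x) = aff k0 x /\
    aff k1 (slide k x) = aff k1 x.
  by rewrite !affD !dotvNr !dotvZr k0u k1u mulr0 oppr0 !addr0.
have slide2 x : aff k2 (slide k2 x) = 0.
  by rewrite affD dotvNr dotvZr divfK// subrr.
have slide3 x : aff k3 (slide k3 x) = 0.
  by rewrite affD dotvNr dotvZr k3u divfK// subrr.
(* The weight is chosen so that [k0] and [k1] agree at [m]; the relation then makes [k2] and [k3]
   vanish together at [slide k2 m]. *)
pose t := aff k0 q / (aff k0 q + aff k1 p).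
have s0 : 0 < aff k0 q + aff k1 p by rewrite addr_gt0.
pose m := t *: p + (1 - t) *: q.
have k0m : aff k0 m = aff k0 q * aff k1 p / (aff k0 q + aff k1 p).
  by rewrite aff_conv k0p /t; field; rewrite gt_eqF.
have k1m : aff k1 m = aff k0 q * aff k1 p / (aff k0 q + aff k1 p).
  by rewrite aff_conv k1q /t; field; rewrite gt_eqF.
have m0 : 0 < aff k0 m by rewrite k0m divr_gt0 ?mulr_gt0.
have e01m : aff k0 m = aff k1 m by rewrite k0m k1m.
have [p0 p1] := slide01 k2 p; have [q0 q1] := slide01 k3 q.
have [z0 z1] := slide01 k2 m.
have p2 := slide2 p; have q3 := slide3 q; have z2 := slide2 m.
(* The relation gives the remaining value at each candidate: [k3] is [aff k1 p] at the first, [k2]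
   is [aff k0 q] at the second, [k3] is 0 at the third. *)
have p3 := rel (slide k2 p); have q2 := rel (slide k3 q).
have z3 := rel (slide k2 m).
exists (slide k2 p), (slide k3 q), (slide k2 m).
have neq (k : 'rV[R]_2 * R) x y : aff k x != aff k y -> x != y.
  by apply: contraNneq => ->.
split; first by apply: (neq k0); rewrite p0 q0 k0p lt_eqF.
- by apply: (neq k0); rewrite p0 z0 k0p lt_eqF.
- by apply: (neq k1); rewrite q1 z1 k1q lt_eqF// -e01m.
have P0 x : P x -> 0 <= aff k0 x by case/PE.
have P1 x : P x -> 0 <= aff k1 x by case/PE.
have P2 x : P x -> 0 <= aff k2 x by case/PE.
have P3 x : P x -> 0 <= aff k3 x by case/PE.
split.
- apply: (extreme_point_aff P0 P2 inj02) => //; last by rewrite p0.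
  by apply/PE; split; lra.
- apply: (extreme_point_aff P1 P3 inj13) => //; last by rewrite q1.
  by apply/PE; split; lra.
- apply: (extreme_point_aff P2 P3 inj23) => //; last by lra.
  by apply/PE; split; lra.
Qed.

(** * Voronoi cells as polyhedra *)

Lemma voronoi_cellP (R : realType) n (T S : {fset 'rV[R]_n}) (x : 'rV[R]_n) :
  voronoi_cell T S x <-> forall s t, s \in S -> t \in (T `\` S)%fset ->
    enorm (x - s) <= enorm (x - t).
Proof.
split=> [/= xST s t sS tT|xST].
  rewrite -lee_fin; rewrite (le_trans _ (le_trans xST _))//.
    exact: (@le_bigmax_seq _ _ _ _ _ s xpredT (fun s => (enorm (x - s))%:E)).
  exact: (@ge_bigmin_seq _ _ _ _ _ t xpredT (fun t => (enorm (x - t))%:E)).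
rewrite /voronoi_cell /=; rewrite big_seq; apply: bigmax_le; first exact: leNye.
move=> s sS; rewrite big_seq; apply: le_bigmin; first exact: leey.
by move=> t tT; rewrite lee_fin xST.
Qed.

(** After squaring, the terms quadratic in [x] cancel. *)
Lemma enorm_sub_le (R : realType) n (s t x : 'rV[R]_n) :
  (enorm (x - s) <= enorm (x - t)) =
  (0 <= aff (2 *: (s - t), dotv t t - dotv s s) x).
Proof.
rewrite ler_sqrt ?dotv_ge0// -subr_ge0 /aff /=; congr (_ <= _).
rewrite ![dotv (_ - _) _]dotvC (dotvC (2 *: _)) !dotvBr dotvZr dotvBr.
rewrite ![dotv (_ - _) _]dotvC !dotvBr (dotvC t x) (dotvC s x); ring.
Qed.

(** With [bool] as index type, [~~] passes to the other element. *)
Lemma cardfs2_bool (K : choiceType) (A : {fset K}) : #|` A| = 2%N ->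
  exists f : bool -> K, forall x, x \in A <-> exists b, x = f b.
Proof.
move=> A2; have [a aA] : exists a, a \in A.
  by apply/fset0Pn; rewrite -cardfs_gt0 A2.
have : #|` A `\ a|%fset == 1%N.
  by move: (cardfsD1 a A); rewrite A2 aA => /eqP; rewrite eqSS eq_sym.
move=> /cardfs1P[b Ab]; exists (fun c : bool => if c then a else b) => x.
have -> : A = [fset a; b]%fset by rewrite -(fsetD1K aA) Ab.
rewrite !inE; split=> [/orP[] /eqP ->|[[] ->]].
- by exists true.
- by exists false.
- by rewrite eqxx.
- by rewrite eqxx orbT.
Qed.

(** Both sides of the relation are the sum of the squared distances to [T] minus [S], less the sum
    of those to [S]. Gradients are nonzero because these two sets are disjoint. *)
Lemma voronoi_cell_polyhedron (R : realType) n (S T : {fset 'rV[R]_n}) :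
    (S `<=` T)%fset -> #|` S| = 2%N -> #|` T| = 4%N ->
  exists2 k : bool * bool -> 'rV[R]_n * R, voronoi_cell T S = polyhedron k &
    (forall i, (k i).1 != 0) /\
    (forall i j x, aff (k (i, j)) x + aff (k (~~ i, ~~ j)) x =
                   aff (k (i, ~~ j)) x + aff (k (~~ i, j)) x).
Proof.
move=> ST S2 T4; have [s sP] := cardfs2_bool S2.
have [t tP] : exists t : bool -> 'rV[R]_n,
    forall x, x \in (T `\` S)%fset <-> exists b, x = t b.
  by apply: cardfs2_bool; rewrite cardfsDS// T4 S2.
exists (fun c => (2 *: (s c.1 - t c.2),
                  dotv (t c.2) (t c.2) - dotv (s c.1) (s c.1))); last split.
- apply/seteqP; split=> x.
    move=> /voronoi_cellP xST c; rewrite -enorm_sub_le; apply: xST.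
      by apply/sP; exists c.1.
    by apply/tP; exists c.2.
  move=> xP; apply/voronoi_cellP => _ _ /sP[i ->] /tP[j ->].
  by rewrite enorm_sub_le; apply: (xP (i, j)).
- move=> c /=; rewrite scaler_eq0 pnatr_eq0 subr_eq0 /=; apply/eqP => e.
  have /tP : exists b, s c.1 = t b by exists c.2.
  by rewrite inE; case/andP => /negP[]; apply/sP; exists c.1.
- move=> i j x; rewrite /aff /= ![dotv (2 *: _) _]dotvC !dotvZr !dotvBr.
  by ring.
Qed.

(** * Counting vertices and the case analysis *)

Lemma card_eq_I2_three (T : choiceType) (A : set T) (x y z : T) :
  (A #= `I_2)%card -> x != y -> x != z -> y != z -> A x -> A y -> A z -> False.
Proof.
move=> A2 xy xz yz Ax Ay Az; have finA : finite_set A by exists 2%N.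
have : ([fset x; y; z] `<=` fset_set A)%fset.
  apply/fsubsetP => w; rewrite !inE in_fset_set// => /orP[/orP[]|] /eqP ->;
    exact: mem_set.
move/fsubset_leq_card; rewrite (card_fset_set A2) fsetUC cardfsU1 !inE cardfs2.
by rewrite negb_or xy eq_sym xz eq_sym yz.
Qed.

(** Both zero sets are the line through [p] with direction [u]. *)
Lemma zero_set_eq (R : realType) (k l : 'rV[R]_2 * R) (u p : 'rV[R]_2) :
    k.1 != 0 -> l.1 != 0 -> u != 0 -> dotv k.1 u = 0 -> dotv l.1 u = 0 ->
    aff k p = 0 -> aff l p = 0 ->
  [set x | aff k x = 0] = [set x | aff l x = 0].
Proof.
move=> k0 l0 u0 ku lu kp lp.
suff sub (h h' : 'rV[R]_2 * R) : h.1 != 0 -> dotv h.1 u = 0 ->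
    dotv h'.1 u = 0 -> aff h p = 0 -> aff h' p = 0 ->
    [set x | aff h x = 0] `<=` [set x | aff h' x = 0].
  by apply/seteqP; split; apply: sub.
move=> h0 hu h'u hp h'p x /= hx.
have [|c /eqP] := @orthogonal_line _ h.1 u (x - p) h0 u0 hu.
  by move: hx hp; rewrite dotvBr /aff; lra.
by rewrite subr_eq addrC => /eqP ->; rewrite affD dotvZr h'u h'p mulr0 addr0.
Qed.

Lemma bool_pair_ind (Q : bool * bool -> Prop) (a b : bool) :
  Q (a, b) -> Q (a, ~~ b) -> Q (~~ a, b) -> Q (~~ a, ~~ b) -> forall c, Q c.
Proof. by case: a b => -[] /= ? ? ? ? [[] []]. Qed.

Theorem proposition3p10 (R : realType) (S T : {fset 'rV[R]_2})
    (subST : (S `<=` T)%fset) (cardS : #|` S| = 2%N) (cardT : #|` T| = 4%N) :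
  ~ two_vertices_parallel_sides (voronoi_cell T S).
Proof.
have [k -> [k0 rel]] := voronoi_cell_polyhedron subST cardS cardT.
move=> [_ V2 _ [F [G [FG sidesE [U dirF dirG]]]]].
have unb K : [set F; G] K -> sides (polyhedron k) K /\ ~ bounded_set K.
  by rewrite -sidesE.
have [[faceF [_ [U1 dirU1 dU1]]] Fub] := unb F (or_introl erefl).
have [[faceG _] _] := unb G (or_intror erefl).
have dU : \dim U = 1%N.
  have UU1 : (U <= U1)%VS by apply: dirF.2 => x y; apply: dirU1.1.
  have U1U : (U1 <= U)%VS by apply: dirU1.2 => x y; apply: dirF.1.
  by rewrite (_ : U = U1)//; apply/eqP; rewrite eqEsubv UU1.
have [_ FP _] := faceF.
have [u [u0 uU ku]] := unbounded_direction FP dirF dU Fub.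
have [[i j] Uf FE] := polyhedron_side k0 faceF dirF dU.
have [[i' j'] Ug GE] := polyhedron_side k0 faceG dirG dU.
have {}Uf := Uf u uU; have {}Ug := Ug u uU.
have [p [_ [Fp _ _ _]]] := direction1 dirF dU.
have [q [_ [Gq _ _ _]]] := direction1 dirG dU.
move: (Fp) (Gq); rewrite FE GE => -[Pp /= fp] [Pq /= gq].
(* If the constraint of [G] vanished at [p], the two zero lines would coincide and [F = G]. *)
have gp : 0 < aff (k (i', j')) p.
  rewrite lt_def Pp andbT; apply/eqP => gp; apply: FG.
  by rewrite FE GE (zero_set_eq _ _ u0 Uf Ug fp gp).
have fq : 0 < aff (k (i, j)) q.
  rewrite lt_def Pq andbT; apply/eqP => fq; apply: FG.
  by rewrite FE GE (zero_set_eq _ _ u0 Uf Ug fq gq).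
(* Otherwise a vertex [v] would be the midpoint of [v + u] and [v - u], both in the cell. *)
have not_all0 : ~ forall c, dotv (k c).1 u = 0.
  move=> ku0; have [v [Pv extv]] : exists v, vertices (polyhedron k) v.
    apply: contrapT => nov; have := card_fset_set V2.
    rewrite (_ : vertices _ = set0) ?fset_set0 ?cardfs0//.
    by rewrite -subset0 => v Vv; apply: nov; exists v.
  have [||||+ _] := extv (v + u) (v - u) 2^-1.
  - by move=> c; rewrite affD ku0 addr0.
  - by move=> c; rewrite affD dotvNr ku0 subr0.
  - by lra.
  - by apply/rowP => c; rewrite !mxE; field.
  by move/eqP; rewrite -subr_eq0 addrC addKr (negPf u0).
have reld a b : dotv (k (a, b)).1 u + dotv (k (~~ a, ~~ b)).1 u =
                dotv (k (a, ~~ b)).1 u + dotv (k (~~ a, b)).1 u.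
  by have := rel a b (p + u); have := rel a b p; rewrite !affD; lra.
have all0 a b : dotv (k (a, b)).1 u = 0 -> dotv (k (a, ~~ b)).1 u = 0 ->
    dotv (k (~~ a, b)).1 u = 0 -> False.
  move=> e0 e1 e2; apply: not_all0.
  have e3 := reld a b.
  have {}e3 : dotv (k (~~ a, ~~ b)).1 u = 0 by lra.
  exact: (@bool_pair_ind (fun c => dotv (k c).1 u = 0) _ _ e0 e1 e2 e3).
have no3 v1 v2 v3 := @card_eq_I2_three _ _ v1 v2 v3 V2.
have boolE (a b : bool) : b = a \/ b = ~~ a.
  by case: a b => -[]; [left|right|right|left].
have [ei|ei] := boolE i i'; have [ej|ej] := boolE j j'; subst i' j'.
- by move: gp; rewrite fp ltxx.
(* The sides share the point of [S]. A zero slope here would be the third one, and the relation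
   would make all four vanish. *)
- have s2 : 0 < dotv (k (~~ i, j)).1 u.
    by rewrite lt_def ku andbT; apply/eqP; apply: all0.
  have [|v1 [v2 [v3 [n12 n13 n23 [V_1 V_2 V_3]]]]] :=
      three_vertices (P := polyhedron k) _ (rel i j) u0 Uf Ug s2 fp gp gq fq.
    move=> x; split=> [Px|[x0 x1 x2 x3]]; first by split; apply: Px.
    exact: (@bool_pair_ind (fun c => 0 <= aff (k c) x) _ _ x0 x1 x2 x3).
  exact: (no3 _ _ _ n12 n13 n23).
(* The sides share the point outside [S]: the same argument with the two middle constraints
   exchanged. *)
- have s2 : 0 < dotv (k (i, ~~ j)).1 u.
    by rewrite lt_def ku andbT; apply/eqP => s2; apply: (all0 i j).
  have rel' x : aff (k (i, j)) x + aff (k (~~ i, ~~ j)) x =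
                aff (k (~~ i, j)) x + aff (k (i, ~~ j)) x.
    by rewrite rel addrC.
  have [|v1 [v2 [v3 [n12 n13 n23 [V_1 V_2 V_3]]]]] :=
      three_vertices (P := polyhedron k) _ rel' u0 Uf Ug s2 fp gp gq fq.
    move=> x; split=> [Px|[x0 x1 x2 x3]]; first by split; apply: Px.
    exact: (@bool_pair_ind (fun c => 0 <= aff (k c) x) _ _ x0 x2 x1 x3).
  exact: (no3 _ _ _ n12 n13 n23).
(* No common index: the other two slopes are nonnegative with sum 0. *)
- have := reld i j; have := ku (i, ~~ j); have := ku (~~ i, j).
  by move=> s1 s2 s; apply: (all0 i j) => //; lra.
Qed.
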